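(* Let $\mathcal{M}^*$ be a periodic assignment. The following statements are equivalent: (i) $\mathcal{M}^*$ is an optimal solution to the Periodic Assignment Problem; (ii) $c(\mathcal{I})+c(\mathcal{M}^* )=LT$; (iii) $\mathcal{I}(t)+\mathcal{M}^*(t)=L$ for all $t\in[0,T)$; (iv) $\mathcal{M}^*(t')=0$ for some $t'\in[0,T)$.
   Context: Let $T$ be a positive integer (the period) and let $\mathcal{I}$ be a finite set of $n\ge 1$ tasks. For $x\in\mathbb{R}$, $[x]_T$ denotes the unique element of $[0,T)$ congruent to $x$ modulo $T$. Each task $i$ is given by $a_i,b_i\in[0,T)$ and occupies the $T$-periodic open interval $(a_i,b_i):=\{t\in[0,T):0<[t-a_i]_T<c(i)\}$, where $c(i):=[b_i-a_i]_T$ is its duration (the interval wraps around $T$ when $a_i>b_i$). For $t\in[0,T)$, $\mathcal{I}(t)$ is the number of tasks whose interval contains $t$, and the load is $L:=\max_{t\in[0,T)}\mathcal{I}(t)$. For every ordered pair $(i,j)$ of tasks (including $i=j$) there is a transition arc with transition time $c_{ij}:=[a_j-b_i]_T$, associated with the $T$-periodic closed interval $[b_i,a_j]:=\{t\in[0,T):[t-b_i]_T\le c_{ij}\}$. A periodic assignment is a set $\mathcal{M}\subseteq\mathcal{I}\times\mathcal{I}$ such that every task has exactly one arc of $\mathcal{M}$ leaving it and exactly one arc of $\mathcal{M}$ entering it. Write $c(\mathcal{I}):=\sum_{i\in\mathcal{I}}c(i)$ and $c(\mathcal{M}):=\sum_{(i,j)\in\mathcal{M}}c_{ij}$; the number of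 workers required by $\mathcal{M}$ is $(c(\mathcal{I})+c(\mathcal{M}))/T$. For $t\in[0,T)$, $\mathcal{M}(t)$ is the number of arcs $(i,j)\in\mathcal{M}$ whose closed periodic interval $[b_i,a_j]$ contains $t$. The Periodic Assignment Problem (PAP) asks for a periodic assignment minimizing $c(\mathcal{M})$.
   Formalization: The implication from (i), (ii) or (iv) to (iii) is proved only when no task is empty (a_i ≠ b_i for all i); with an empty task (iii) always fails (e.g. n=1, a_1=b_1=0), so the equivalence as stated is false there. All other implications hold for all tasks. *)

(* Defs.v *)
From HB Require Import structures.
From mathcomp Require Import all_boot all_order all_algebra.
From mathcomp Require Import boolp reals.

Set Implicit Arguments.
Unset Strict Implicit.
Unset Printing Implicit Defensive.

Import Order.TTheory GRing.Theory Num.Theory.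
Local Open Scope ring_scope.

Definition pmod {R : realType} (T : nat) (x : R) : R :=
  x - (Num.floor (x / T%:R))%:~R * T%:R.

Lemma pmod_itv (R : realType) (T : nat) (x : R) :
  (0 < T)%N -> 0 <= pmod T x < T%:R.
Proof.
move=> T0; have T0r : 0 < T%:R :> R by rewrite ltr0n.
rewrite /pmod subr_ge0 -ler_pdivlMr // floor_le /=.
have := floorD1_gt (x / T%:R).
by rewrite ltr_pdivrMr // intrD mulrDl mul1r ltrBlDr addrC.
Qed.

Lemma pmod_unique (R : realType) (T : nat) (x y : R) (k : int) :
  (0 < T)%N -> 0 <= y < T%:R -> x = y + k%:~R * T%:R -> pmod T x = y.
Proof.
move=> T0 /andP[y0 yT] ->; have T0r : 0 < T%:R :> R by rewrite ltr0n.
have yd : Num.floor ((y + k%:~R * T%:R) / T%:R) = k.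
  apply: floor_def; rewrite mulrDl mulfK ?gt_eqF // lerDr divr_ge0 ?(ltW T0r) //=.
  by rewrite intrD addrC ltrD2l ltr_pdivrMr // mul1r.
by rewrite /pmod yd addrK.
Qed.

Section PeriodicAssignment.
Variables (R : realType) (T : nat) (I : finType) (a b : I -> R).
Implicit Types (t : R) (i j : I) (M : {set I * I}).

Definition duration i : R := pmod T (b i - a i).

Definition transition_time i j : R := pmod T (a j - b i).

Definition in_task t i : bool := 0 < pmod T (t - a i) < duration i.

Definition in_arc t (e : I * I) : bool :=
  pmod T (t - b e.1) <= transition_time e.1 e.2.

Definition tasks_at t : nat := #|[set i | in_task t i]|.

Definition arcs_at M t : nat := #|[set e in M | in_arc t e]|.

(* [tasks_at] takes values in {0, ..., #|I|}, so its maximum over the reals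
   0 <= t < T is the largest such value that is attained; see [loadP]. *)
Definition load : nat :=
  \max_(k < #|I|.+1 | `[< exists2 t, 0 <= t < T%:R & tasks_at t = k >]) k.

Definition periodic_assignment M : bool :=
  [forall i, (#|[set j | (i, j) \in M]| == 1%N) &&
             (#|[set j | (j, i) \in M]| == 1%N)].

Definition tasks_cost : R := \sum_(i : I) duration i.

Definition assignment_cost M : R :=
  \sum_(e in M) transition_time e.1 e.2.

Definition pap_optimal M : Prop :=
  periodic_assignment M /\
  forall M', periodic_assignment M' -> assignment_cost M <= assignment_cost M'.

Lemma loadP : (0 < T)%N ->
  (exists2 t, 0 <= t < T%:R & tasks_at t = load) /\
  (forall t, 0 <= t < T%:R -> (tasks_at t <= load)%N).
Proof.
move=> T0.
have lt_n t : (tasks_at t < #|I|.+1)%N by rewrite ltnS max_card.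
split=> [|t tT].
  have P0 : `[< exists2 t, 0 <= t < T%:R
               & tasks_at t = Ordinal (lt_n 0) >].
    by apply/asboolP; exists 0; rewrite ?lexx ?ltr0n.
  rewrite /load (bigop.bigmax_eq_arg (Ordinal (lt_n 0))) //.
  by case: fintype.arg_maxnP => // k /asboolP.
apply: (@leq_bigmax_cond _ _ (fun k : 'I_#|I|.+1 => k : nat) (Ordinal (lt_n t))).
by apply/asboolP; exists t.
Qed.

End PeriodicAssignment.

(* Main.v *)
Require Import Defs.
From mathcomp Require Import all_boot all_order all_algebra.
From mathcomp Require Import perm reals lra.
Import Order.TTheory GRing.Theory Num.Theory.
Local Open Scope ring_scope.

(** Let [D t] count the tasks of duration zero located at [t]. For every
    assignment [M] and every [t], summing the arcs and tasks along the cycles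
    of [M] gives [c(I) + c(M) = T (I(t) + M(t) - D(t))], and [D t <= M(t)]
    because the arc leaving an empty task at [t] contains [t]. Hence
    [c(I) + c(M) >= L T], with equality as soon as [M(t) = 0] for some [t].
    Conversely the load is attained at some [t] away from all endpoints, where
    [D t = 0], so equality forces [M(t) = 0] there. Reading time from such a
    [t] and matching the k-th ending with the k-th start yields an assignment
    with [M(t) = 0]: if the k-th start preceded the k-th ending, more than [L]
    tasks would be running in between. So the bound [L T] is always attained. *)

Section Matching.
Variables (R : realFieldType) (I : finType).
Implicit Types (f g : I -> R).

Lemma positive_lower_bound f :
  (forall i, 0 < f i) -> exists2 e, 0 < e & forall i, e < f i.
Proof.
move=> f_gt0; pose m := \big[Num.min/1]_i f i.
have m_gt0 : 0 < m.
  by apply: (big_ind (fun x => 0 < x)) => // x y; rewrite lt_min => -> ->.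
exists (m / 2); first by rewrite divr_gt0.
move=> i; apply: (@lt_le_trans _ _ m); first by lra.
by rewrite /m (bigD1 i) //= ge_min lexx.
Qed.

Let sorted_enum f := sort (relpre f <=%R) (enum I).

Let sorted_enum_sorted f : sorted (relpre f <=%R) (sorted_enum f).
Proof. by apply: sort_sorted => i j; apply: le_total. Qed.

Let mem_sorted_enum f i : i \in sorted_enum f.
Proof. by rewrite mem_sort mem_enum. Qed.

Let sorted_enum_uniq f : uniq (sorted_enum f).
Proof. by rewrite sort_uniq enum_uniq. Qed.

Let size_sorted_enum f : size (sorted_enum f) = #|I|.
Proof. by rewrite size_sort -cardE. Qed.

Let sorted_enum_le f i0 m n : (m <= n < #|I|)%N ->
  f (nth i0 (sorted_enum f) m) <= f (nth i0 (sorted_enum f) n).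
Proof.
move=> /andP[mn nI].
have tr : transitive (relpre f <=%R) by move=> ? ? ?; apply: le_trans.
have rf : reflexive (relpre f <=%R) by move=> ?; apply: lexx.
apply: (sorted_leq_nth tr rf i0 (sorted_enum_sorted f)) => //.
  by rewrite inE size_sorted_enum (leq_ltn_trans mn).
by rewrite inE size_sorted_enum.
Qed.

Lemma dominating_perm f g :
  (forall x, (#|[set i | (f i < x)%R]| <= #|[set i | (g i <= x)%R]|)%N) ->
  exists s : {perm I}, forall i, g i <= f (s i).
Proof.
move=> fg; pose s i := nth i (sorted_enum f) (index i (sorted_enum g)).
have idx i : (index i (sorted_enum g) < #|I|)%N.
  by rewrite -(size_sorted_enum g) index_mem.
have s_inj : injective s.
  move=> i j; rewrite /s (set_nth_default i j) ?size_sorted_enum // => /eqP.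
  rewrite nth_uniq ?size_sorted_enum // => /eqP eij.
  by rewrite -(nth_index i (mem_sorted_enum g i)) eij nth_index.
exists (perm s_inj) => i; rewrite permE leNgt; apply/negP => fg_lt.
set k := index i (sorted_enum g).
pose x := (f (s i) + g i) / 2.
have [fx gx] : f (s i) < x /\ x < g i by rewrite /x; split; lra.
have := fg x; apply/negP; rewrite -ltnNge.
apply: (@leq_trans k.+1).
  rewrite ltnS.
  apply: (@leq_trans #|[set j in take k (sorted_enum g)]|).
    apply/subset_leq_card/subsetP => j; rewrite !inE => gj.
    rewrite in_take ?mem_sorted_enum // ltnNge; apply/negP => kj.
    have := sorted_enum_le g i k (index j (sorted_enum g)).
    rewrite kj idx !nth_index ?mem_sorted_enum // => /(_ isT).
    by rewrite leNgt (le_lt_trans gj gx).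
  rewrite cardsE (leq_trans (card_size _)) // size_take_min.
  exact: geq_minl.
have -> : k.+1 = #|[set j in take k.+1 (sorted_enum f)]|.
  rewrite cardsE (card_uniqP _) ?take_uniq // size_take_min size_sorted_enum.
  by apply/esym/minn_idPl; apply: idx.
apply/subset_leq_card/subsetP => j; rewrite !inE.
rewrite in_take ?mem_sorted_enum // ltnS => jk.
have := sorted_enum_le f i (index j (sorted_enum f)) k.
rewrite jk idx nth_index ?mem_sorted_enum // => /(_ isT).
by move/le_lt_trans; apply.
Qed.

End Matching.

Section Pmod.
Variables (R : realType) (T : nat) (T_gt0 : (0 < T)%N).
Implicit Types x y : R.

Lemma pmodE x : exists k : int, x = pmod T x + k%:~R * T%:R.
Proof. by exists (Num.floor (x / T%:R)); rewrite /pmod subrK. Qed.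

Lemma pmodD x y :
  pmod T (x + y) = pmod T x + pmod T y
                   - T%:R *+ (T%:R <= pmod T x + pmod T y)%R.
Proof.
have [k xE] := pmodE x; have [l yE] := pmodE y.
have /andP[x0 xT] := pmod_itv x T_gt0; have /andP[y0 yT] := pmod_itv y T_gt0.
have kl (e : int) : x + y = (pmod T x + pmod T y - e%:~R * T%:R) +
                       (k + l + e)%:~R * T%:R.
  by rewrite {1}xE {1}yE !intrD; lra.
case: (leP T%:R) => h; rewrite ?mulr1n ?mulr0n.
  have := kl 1; rewrite mulr1z mul1r => kl1.
  by apply: (pmod_unique T_gt0 _ kl1); apply/andP; split; lra.
have := kl 0; rewrite mulr0z mul0r => kl0.
by apply: (pmod_unique T_gt0 _ kl0); rewrite subr0; apply/andP; split; lra.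
Qed.

Lemma pmod_id x : 0 <= x < T%:R -> pmod T x = x.
Proof.
move=> xT; apply: (pmod_unique (k := 0) T_gt0 xT).
by rewrite mulr0z mul0r addr0.
Qed.

Lemma pmod_pmodD x y : pmod T (pmod T x + y) = pmod T (x + y).
Proof. by rewrite pmodD [RHS]pmodD (pmod_id (pmod T x)) ?pmod_itv. Qed.

Lemma pmod_eq0 x y :
  0 <= x < T%:R -> 0 <= y < T%:R -> pmod T (x - y) = 0 -> x = y.
Proof.
move=> xT yT xy0; rewrite -(pmod_id x) // -[x](subrK y) pmodD xy0 add0r.
by rewrite (pmod_id y) // leNgt (andP yT).2 subr0.
Qed.

Lemma pmodN x : 0 < pmod T x -> pmod T (- x) = T%:R - pmod T x.
Proof.
have /andP[x0 xT] := pmod_itv x T_gt0.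
have /andP[y0 yT] := pmod_itv (- x) T_gt0.
have := pmodD x (- x); rewrite subrr pmod_id ?lexx ?ltr0n //.
by case: (leP T%:R); rewrite ?mulr1n ?mulr0n => *; lra.
Qed.

End Pmod.

Section Assignments.
Variables (R : realType) (T : nat) (I : finType) (a b : I -> R).
Hypothesis T_gt0 : (0 < T)%N.
Implicit Types (t u : R) (M : {set I * I}) (s : {perm I}).

Let T_gt0R : 0 < T%:R :> R. Proof. by rewrite ltr0n. Qed.

Definition perm_assignment s : {set I * I} := [set (i, s i) | i in I].

Lemma in_perm_assignment s i j : ((i, j) \in perm_assignment s) = (j == s i).
Proof.
apply/imsetP/eqP => [[k _ [-> ->]] //|->].
by exists i.
Qed.

Lemma perm_assignmentP s : periodic_assignment (perm_assignment s).
Proof.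
apply/forallP => i; apply/andP; split; apply/cards1P.
  by exists (s i); apply/setP => j; rewrite !inE in_perm_assignment.
exists (s^-1%g i); apply/setP => j; rewrite !inE in_perm_assignment.
by rewrite eq_sym (canF_eq (permK s)).
Qed.

Lemma periodic_assignment_perm M :
  periodic_assignment M -> exists s, M = perm_assignment s.
Proof.
move=> /forallP M_pa.
have out i : exists j, [set k | (i, k) \in M] == [set j].
  by case/andP: (M_pa i) => /cards1P[j ->] _; exists j.
pose f i := xchoose (out i).
have fE i j : ((i, j) \in M) = (j == f i).
  by have /eqP/setP/(_ j) := xchooseP (out i); rewrite !inE.
have f_inj : injective f.
  move=> i j fij; case/andP: (M_pa (f i)) => _ /cards1P[k /setP Mk].
  have := Mk i; rewrite !inE fE eqxx => /esym/eqP ->.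
  by have := Mk j; rewrite !inE fE fij eqxx => /esym/eqP ->.
exists (perm f_inj); apply/setP => -[i j].
by rewrite in_perm_assignment permE fE.
Qed.

Lemma assignment_cost_perm s : assignment_cost T a b (perm_assignment s) =
  \sum_i transition_time T a b i (s i).
Proof. by rewrite /assignment_cost big_imset //= => i j _ _ []. Qed.

Lemma arcs_at_perm s t : arcs_at T a b (perm_assignment s) t =
  #|[set i | in_arc T a b t (i, s i)]|.
Proof.
have inj : injective (fun i => (i, s i)) by move=> i j [].
rewrite /arcs_at -(card_imset _ inj); apply: eq_card => -[i j].
rewrite !inE in_perm_assignment.
apply/andP/imsetP => [[/eqP -> h]|[k]]; first by exists i; rewrite ?inE.
by rewrite inE => h [-> ->].
Qed.

Definition empty_task_at t i : bool :=
  (pmod T (t - a i) == 0) && (duration T a b i == 0).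

Definition empty_tasks_at t : nat := #|[set i | empty_task_at t i]|.

Lemma in_taskE t i : T%:R *+ in_task T a b t i =
  duration T a b i + pmod T (t - b i) - pmod T (t - a i)
  - T%:R *+ (pmod T (t - a i) == 0)%R + T%:R *+ empty_task_at t i :> R.
Proof.
rewrite /in_task /empty_task_at.
have /andP[p0 pT] := pmod_itv (t - a i) T_gt0.
have /andP[q0 qT] := pmod_itv (t - b i) T_gt0.
have /andP[c0 cT] := pmod_itv (b i - a i) T_gt0.
have := pmodD _ _ T_gt0 (b i - a i) (t - b i).
have -> : b i - a i + (t - b i) = t - a i by lra.
rewrite /duration; move: p0 pT q0 qT c0 cT.
move: (pmod T (t - a i)) (pmod T (t - b i)) (pmod T (b i - a i)) => p q c.
move=> p0 pT q0 qT c0 cT.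
have [?|?|?] := ltgtP p 0; have [?|?|?] := ltgtP c 0; have [?|?] := ltP p c;
  case: (leP T%:R); rewrite /= ?mulr1n ?mulr0n => *; lra.
Qed.

Lemma in_arcE t i j : T%:R *+ in_arc T a b t (i, j) =
  transition_time T a b i j + pmod T (t - a j) - pmod T (t - b i)
  + T%:R *+ (pmod T (t - a j) == 0)%R :> R.
Proof.
rewrite /in_arc /= /transition_time.
have /andP[p0 pT] := pmod_itv (t - a j) T_gt0.
have /andP[q0 qT] := pmod_itv (t - b i) T_gt0.
have /andP[c0 cT] := pmod_itv (a j - b i) T_gt0.
have := pmodD _ _ T_gt0 (a j - b i) (t - a j).
have -> : a j - b i + (t - a j) = t - b i by lra.
move: p0 pT q0 qT c0 cT.
move: (pmod T (t - a j)) (pmod T (t - b i)) (pmod T (a j - b i)) => p q c.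
move=> p0 pT q0 qT c0 cT.
have [?|?|?] := ltgtP p 0; have [?|?] := leP q c;
  case: (leP T%:R); rewrite /= ?mulr1n ?mulr0n => *; lra.
Qed.

Lemma sum_indicator (P : pred I) :
  \sum_i T%:R *+ P i = T%:R *+ #|[set i | P i]| :> R.
Proof.
rewrite -sumr_const [RHS]big_mkcond /=.
by apply: eq_bigr => i _; rewrite inE; case: (P i).
Qed.

Lemma tasks_atE t : T%:R *+ tasks_at T a b t =
  \sum_i (duration T a b i + pmod T (t - b i) - pmod T (t - a i)
          - T%:R *+ (pmod T (t - a i) == 0)%R) + T%:R *+ empty_tasks_at t :> R.
Proof.
rewrite -!sum_indicator -big_split /=.
by apply: eq_bigr => i _; rewrite in_taskE.
Qed.

Lemma total_cost M t : periodic_assignment M ->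
  tasks_cost T a b + assignment_cost T a b M + T%:R *+ empty_tasks_at t =
  T%:R *+ (tasks_at T a b t + arcs_at T a b M t).
Proof.
move=> /periodic_assignment_perm[s ->].
rewrite mulrnDr tasks_atE arcs_at_perm assignment_cost_perm.
rewrite -[X in _ = _ + X]sum_indicator.
(* Stated for abstract functions because [big_split] would otherwise split
   the subtraction inside [pmod]. *)
have cycle (d e q f : I -> R) z :
    \sum_i d i + \sum_i e i + z =
    \sum_i (d i + q i - f i) + z + \sum_i (e i - q i + f (s i)).
  have fs : \sum_i f (s i) = \sum_i f i.
    by rewrite [RHS](reindex_inj (@perm_inj _ s)).
  rewrite !big_split /= !sumrN fs; lra.
pose F i := pmod T (t - a i) + T%:R *+ (pmod T (t - a i) == 0)%R.
rewrite /tasks_cost (cycle _ _ (fun i => pmod T (t - b i)) F).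
by congr (_ + _ + _); apply: eq_bigr => i _; rewrite ?in_arcE /F; lra.
Qed.

Lemma empty_tasks_at_le M t : periodic_assignment M ->
  (empty_tasks_at t <= arcs_at T a b M t)%N.
Proof.
move=> /periodic_assignment_perm[s ->]; rewrite arcs_at_perm.
apply/subset_leq_card/subsetP => i; rewrite !inE => /andP[/eqP p0 /eqP c0].
rewrite /in_arc /=; have := pmodD _ _ T_gt0 (b i - a i) (t - b i).
have -> : b i - a i + (t - b i) = t - a i by lra.
have /andP[q0 qT] := pmod_itv (t - b i) T_gt0.
have /andP[d0 _] := pmod_itv (a (s i) - b i) T_gt0.
rewrite p0 [pmod T (b i - a i)]c0 /transition_time.
by case: (leP T%:R); rewrite ?mulr1n ?mulr0n => *; lra.
Qed.

Lemma load_le_total_cost M : periodic_assignment M ->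
  T%:R *+ load T a b <= tasks_cost T a b + assignment_cost T a b M.
Proof.
move=> M_pa; have [[t tT <-] _] := loadP a b T_gt0.
rewrite -(lerD2r (T%:R *+ empty_tasks_at t)) total_cost // -mulrnDr.
by rewrite ler_pMn2l // leq_add2l empty_tasks_at_le.
Qed.

Lemma total_cost_arcs_at0 M t : periodic_assignment M -> 0 <= t < T%:R ->
  arcs_at T a b M t = 0%N ->
  tasks_cost T a b + assignment_cost T a b M = T%:R *+ load T a b.
Proof.
move=> M_pa tT M0; apply/eqP; rewrite eq_le load_le_total_cost // andbT.
have := total_cost M t M_pa; have := empty_tasks_at_le M t M_pa.
rewrite M0 leqn0 addn0 => /eqP ->; rewrite mulr0n addr0 => ->.
by have [_ le_load] := loadP a b T_gt0; rewrite ler_pMn2l // le_load.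
Qed.

Lemma load_attained_generic : exists t, [/\ 0 <= t < T%:R,
  tasks_at T a b t = load T a b &
  forall i, 0 < pmod T (t - a i) /\ 0 < pmod T (t - b i)].
Proof.
have [[t /andP[t0 tT] tL] le_load] := loadP a b T_gt0.
pose gap i := Num.min
  (Num.min (T%:R - pmod T (t - a i)) (T%:R - pmod T (t - b i)))
  (if in_task T a b t i then duration T a b i - pmod T (t - a i) else 1).
pose room (o : option I) := if o is Some i then gap i else T%:R - t.
have [|e e0 e_lt] := @positive_lower_bound R (option I) room.
  case=> [i|] /=; last by rewrite subr_gt0.
  rewrite /gap !lt_min !subr_gt0.
  rewrite (andP (pmod_itv _ T_gt0)).2 (andP (pmod_itv _ T_gt0)).2 /=.
  by case: ifP => [/andP[_]|]; rewrite ?subr_gt0.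
have shift x : e < T%:R - pmod T (t - x) ->
    pmod T (t + e - x) = pmod T (t - x) + e.
  move=> ex; rewrite -addrA [e - x]addrC addrA pmodD //.
  have /andP[x0 xT] := pmod_itv (t - x) T_gt0.
  rewrite (pmod_id _ _ T_gt0 e); last by apply/andP; split; lra.
  by case: (leP T%:R); rewrite ?mulr1n ?mulr0n => *; lra.
have eT := e_lt None; rewrite /= in eT.
have et : 0 <= t + e < T%:R by apply/andP; split; lra.
exists (t + e); split=> //.
  apply/eqP; rewrite eqn_leq le_load //= -tL.
  apply/subset_leq_card/subsetP => i; rewrite !inE => ti.
  have := e_lt (Some i); rewrite /= /gap ti !lt_min -andbA.
  move=> /and3P[ea _ ed]; rewrite /in_task shift //.
  by move: ti => /andP[? ?]; apply/andP; split; lra.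
move=> i; have := e_lt (Some i); rewrite /= /gap !lt_min -andbA.
move=> /and3P[ea eb _]; rewrite !shift //.
have /andP[? _] := pmod_itv (t - a i) T_gt0.
by have /andP[? _] := pmod_itv (t - b i) T_gt0; split; lra.
Qed.

Lemma tasks_at_pmod u : tasks_at T a b (pmod T u) = tasks_at T a b u.
Proof. by apply: eq_card => i; rewrite !inE /in_task pmod_pmodD. Qed.

(* Times are read from [t]: [pmod T (x - t)] is the delay until [x] occurs. *)
Lemma starts_le_endings t x : 0 <= t < T%:R ->
  tasks_at T a b t = load T a b ->
  (forall i, 0 < pmod T (t - a i) /\ 0 < pmod T (t - b i)) ->
  (#|[set i | (pmod T (a i - t) < x)%R]| <=
   #|[set i | (pmod T (b i - t) <= x)%R]|)%N.
Proof.
move=> tT tL gen.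
have [x0|x0] := leP x 0.
  rewrite (_ : [set i | _] = set0) ?cards0 //; apply/setP => i; rewrite !inE.
  have /andP[? _] := pmod_itv (a i - t) T_gt0.
  by apply/negbTE; rewrite -leNgt; lra.
have [xT|xT] := leP T%:R x.
  apply/subset_leq_card/subsetP => i _; rewrite inE.
  by have /andP[_ ?] := pmod_itv (b i - t) T_gt0; lra.
have [_ /(_ (pmod T (t + x)))] := loadP a b T_gt0.
rewrite pmod_itv // => /(_ isT); rewrite tasks_at_pmod -tL => le_load.
have shift y : 0 < pmod T (t - y) -> pmod T (t + x - y) =
    pmod T (t - y) + x - T%:R *+ (pmod T (y - t) <= x)%R.
  move=> y0; have -> : t + x - y = (t - y) + x by lra.
  rewrite -(opprB t y) pmodN // (pmodD _ _ T_gt0 (t - y) x).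
  rewrite (pmod_id _ _ T_gt0 x); last by apply/andP; split; lra.
  by rewrite lerBlDl [_ + x]addrC.
have shift0 i : (pmod T (t + x - a i) == 0) = (pmod T (a i - t) == x).
  have /andP[? ?] := pmod_itv (t - a i) T_gt0.
  rewrite shift ?(gen i).1 // -(opprB t (a i)) pmodN ?(gen i).1 //.
  have a_gt0 := (gen i).1; case: leP; rewrite ?mulr1n ?mulr0n => ?;
    by apply/eqP/eqP; lra.
rewrite -(ler_pMn2l T_gt0R) -!sum_indicator.
rewrite -(ler_pMn2l T_gt0R) !tasks_atE in le_load.
have D0 : empty_tasks_at t = 0%N.
  apply/eqP; rewrite cards_eq0; apply/eqP/setP => i; rewrite !inE.
  by rewrite /empty_task_at gt_eqF // (gen i).1.
rewrite D0 mulr0n addr0 in le_load.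
rewrite -subr_ge0 -sumrB.
move: le_load; rewrite -subr_ge0 opprD addrA -sumrB => le_load.
apply: (le_trans le_load); rewrite lerBlDr ler_wpDr ?mulrn_wge0 //.
apply: ler_sum => i _; rewrite shift0 !shift ?(gen i).1 ?(gen i).2 //.
rewrite [pmod _ (t - a i) == 0]gt_eqF ?(gen i).1 //.
have [?|?|?] := ltgtP (pmod T (a i - t)) x;
  rewrite /= ?mulr1n ?mulr0n => *; lra.
Qed.

Lemma exists_tight_assignment : exists2 M, periodic_assignment M &
  tasks_cost T a b + assignment_cost T a b M = T%:R *+ load T a b.
Proof.
have [t [tT tL gen]] := load_attained_generic.
have [s le_s] :=
  dominating_perm _ _ _ _ (fun x => starts_le_endings t x tT tL gen).
exists (perm_assignment s); first exact: perm_assignmentP.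
apply: (total_cost_arcs_at0 _ t) => //; first exact: perm_assignmentP.
rewrite arcs_at_perm; apply/eqP; rewrite cards_eq0; apply/eqP/setP => i.
rewrite !inE /in_arc /= /transition_time; apply/negbTE; rewrite -ltNge.
have -> : a (s i) - b i = a (s i) - t + (t - b i) by lra.
have := le_s i.
rewrite (pmodD _ _ T_gt0 (a (s i) - t)) -(opprB t (b i)) pmodN ?(gen i).2 //.
have /andP[_ ?] := pmod_itv (a (s i) - t) T_gt0.
by case: (leP T%:R); rewrite ?mulr1n ?mulr0n => *; lra.
Qed.

Lemma pap_optimal_total_cost M : periodic_assignment M ->
  pap_optimal T a b M <->
  tasks_cost T a b + assignment_cost T a b M = T%:R *+ load T a b.
Proof.
move=> M_pa; split=> [[_ M_min]|M_tight].
  have [M' M'_pa M'_tight] := exists_tight_assignment.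
  apply/eqP; rewrite eq_le load_le_total_cost // andbT -M'_tight.
  by rewrite lerD2l M_min.
split=> // M' M'_pa.
by rewrite -(lerD2l (tasks_cost T a b)) M_tight load_le_total_cost.
Qed.

Lemma total_cost_exists_arcs_at0 M : periodic_assignment M ->
  tasks_cost T a b + assignment_cost T a b M = T%:R *+ load T a b ->
  exists2 t, 0 <= t < T%:R & arcs_at T a b M t = 0%N.
Proof.
move=> M_pa M_tight; have [t [tT tL gen]] := load_attained_generic.
exists t => //; have := total_cost M t M_pa.
have -> : empty_tasks_at t = 0%N.
  apply/eqP; rewrite cards_eq0; apply/eqP/setP => i; rewrite !inE.
  by rewrite /empty_task_at gt_eqF // (gen i).1.
rewrite M_tight mulr0n addr0 -tL => /(mulrIn (lt0r_neq0 T_gt0R))/eqP.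
by rewrite -[X in X == _]addn0 eqn_add2l => /eqP.
Qed.

Lemma tasks_arcs_at_total_cost M t : periodic_assignment M ->
  (tasks_at T a b t + arcs_at T a b M t)%N = load T a b ->
  tasks_cost T a b + assignment_cost T a b M = T%:R *+ load T a b.
Proof.
move=> M_pa tL; apply/eqP; rewrite eq_le load_le_total_cost // andbT.
by rewrite -tL -total_cost // lerDl mulrn_wge0.
Qed.

Lemma total_cost_tasks_arcs_at M t : periodic_assignment M ->
  (forall i, duration T a b i != 0) ->
  tasks_cost T a b + assignment_cost T a b M = T%:R *+ load T a b ->
  (tasks_at T a b t + arcs_at T a b M t)%N = load T a b.
Proof.
move=> M_pa c_neq0 M_tight; have := total_cost M t M_pa.
have -> : empty_tasks_at t = 0%N.
  apply/eqP; rewrite cards_eq0; apply/eqP/setP => i; rewrite !inE.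
  by rewrite /empty_task_at (negbTE (c_neq0 i)) andbF.
by rewrite M_tight mulr0n addr0 => /(mulrIn (lt0r_neq0 T_gt0R)).
Qed.

End Assignments.

Theorem theorem1 (R : realType) (T : nat) (I : finType) (a b : I -> R)
    (T_gt0 : (0 < T)%N) (I_gt0 : (0 < #|I|)%N)
    (a_itv : forall i, 0 <= a i < T%:R) (b_itv : forall i, 0 <= b i < T%:R)
    (M : {set I * I}) (M_pa : periodic_assignment M) :
  let s1 := pap_optimal T a b M in
  let s2 := tasks_cost T a b + assignment_cost T a b M
              = (load T a b)%:R * T%:R in
  let s3 := forall t : R, 0 <= t < T%:R ->
              (tasks_at T a b t + arcs_at T a b M t)%N = load T a b in
  let s4 := exists2 t : R, 0 <= t < T%:R & arcs_at T a b M t = 0%N in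
  [/\ s1 <-> s2, s2 <-> s4, s3 -> s2
    (* [s3] fails as soon as some task is empty, i.e. [a i = b i] *)
    & (forall i, a i <> b i) -> s2 -> s3].
Proof.
move=> s1 s2 s3 s4; rewrite /s2 [_%:R * _]mulr_natl; split.
- exact: pap_optimal_total_cost.
- split; first exact: total_cost_exists_arcs_at0.
  by case=> t tT; apply: total_cost_arcs_at0.
- move=> /(_ 0); rewrite lexx ltr0n T_gt0 => /(_ isT).
  exact: tasks_arcs_at_total_cost.
move=> ab M_tight t _; apply: total_cost_tasks_arcs_at => // i.
apply/eqP => c0; apply: (ab i); apply/esym.
exact: (pmod_eq0 _ _ T_gt0).
Qed.
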